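(* For every finite simple connected $r$-regular bipartite graph $\Gamma$, we have \[\mathrm{pmd}(\Gamma)\leq\binom{r}{2}+2.\]
   Context: A matching $M$ (a set of pairwise disjoint edges) of a graph $\Gamma=(V,E)$ is positive if there is $w\colon V\to\mathbb{R}$ with $w(u)+w(v)>0$ for every $uv\in M$ and $w(u)+w(v)<0$ for every $uv\in E\setminus M$. A positive matching decomposition (pmd) of $\Gamma$ is a partition $E=E_1\cup\cdots\cup E_p$ into pairwise disjoint subsets such that $E_i$ is a positive matching of $(V,E\setminus\bigcup_{j<i}E_j)$ for $i=1,\ldots,p$. $\mathrm{pmd}(\Gamma)$ denotes the smallest $p$ for which $\Gamma$ has a pmd with $p$ parts ($0$ if $\Gamma$ has no edges). *)

(* Defs.v *)
From mathcomp Require Import all_boot all_order all_algebra.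
From mathcomp Require Import boolp reals.
Set Implicit Arguments.
Unset Strict Implicit.
Unset Printing Implicit Defensive.
Import Order.TTheory GRing.Theory Num.Theory.
Local Open Scope ring_scope.

Record sgraph := SGraph {
  vertex :> finType;
  adj : rel vertex;
  adj_sym : symmetric adj;
  adj_irrefl : irreflexive adj }.

(* An edge uv is the two-element set [set u; v]. *)
Definition edges (G : sgraph) : {set {set G}} :=
  [set [set p.1; p.2] | p in [set p : G * G | adj p.1 p.2]].

Definition regular (r : nat) (G : sgraph) : Prop :=
  forall x : G, #|[set y | adj x y]| = r.

Definition connected (G : sgraph) : Prop :=
  (0 < #|G|)%N /\ forall x y : G, connect (@adj G) x y.

Definition bipartite (G : sgraph) : Prop :=
  exists A : {set G}, forall x y : G, adj x y -> (x \in A) != (y \in A).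

(* M is a positive matching of the graph with vertex set V and edge set E;
   E is meant to consist of two-element sets. *)
Definition positive_matching (R : realType) (V : finType)
    (E M : {set {set V}}) : Prop :=
  [/\ M \subset E, trivIset M &
      exists w : V -> R,
        (forall u v, [set u; v] \in M -> 0 < w u + w v) /\
        (forall u v, [set u; v] \in E :\: M -> w u + w v < 0)].

Definition is_pmd (R : realType) (G : sgraph) (p : nat)
    (E_ : 'I_p -> {set {set G}}) : Prop :=
  [/\ \bigcup_(i < p) E_ i = edges G,
      forall i j : 'I_p, i != j -> [disjoint E_ i & E_ j] &
      forall i : 'I_p, positive_matching R
        (edges G :\: \bigcup_(j < p | (j < i)%N) E_ j) (E_ i)].

Definition has_pmd (R : realType) (G : sgraph) (p : nat) : Prop :=
  exists E_ : 'I_p -> {set {set G}}, is_pmd R E_.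

Lemma edge_neq (G : sgraph) (u v : G) : [set u; v] \in edges G -> u != v.
Proof.
move=> /imsetP[[a b]]; rewrite inE /= => ab uv.
have anb : a != b by apply: contraTneq ab => ->; rewrite adj_irrefl.
have : #|[set u; v]| = 2 by rewrite uv cards2 anb.
by rewrite cards2; case: (u != v).
Qed.

Lemma positive_matching1 (R : realType) (G : sgraph) (E : {set {set G}}) e :
  E \subset edges G -> e \in E -> positive_matching R E [set e].
Proof.
move=> sE eE; split; first by rewrite sub1set.
  by apply/trivIsetP => A B /set1P-> /set1P->; rewrite eqxx.
have /imsetP[[a b] _ /= eab] := subsetP sE _ eE.
exists (fun x => if x \in e then 1 else - 2%:R); split=> u v.
  move=> /set1P <-; rewrite !inE !eqxx orbT /=.
  by rewrite addr_gt0.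
rewrite !inE => /andP[uve /(subsetP sE)/edge_neq uv].
have L0 : 1 + - 2%:R < 0 :> R by rewrite subr_lt0 ltr1n.
case: ifP => ue; case: ifP => ve //; last 2 first.
- by rewrite addrC.
- by rewrite -opprD oppr_lt0 addr_gt0.
case/negP: uve; move: ue ve uv; rewrite eab !inE.
by case/orP=> /eqP-> /orP[] /eqP->; rewrite ?eqxx // setUC.
Qed.

Lemma has_pmd_edges (R : realType) (G : sgraph) : has_pmd R G #|edges G|.
Proof.
exists (fun i => [set enum_val i]); split.
- apply/setP => e; apply/bigcupP/idP => [[i _ /set1P->]|eE].
    exact: enum_valP.
  by exists (enum_rank_in eE e); rewrite // inE enum_rankK_in.
- move=> i j ij; rewrite disjoints1 inE.
  by apply: contra ij => /eqP/enum_val_inj->.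
- move=> i; apply: positive_matching1; first exact: subsetDl.
  rewrite inE enum_valP andbT; apply/bigcupP => -[j ji /set1P/enum_val_inj ij].
  by rewrite ij ltnn in ji.
Qed.

Lemma ex_pmd (R : realType) (G : sgraph) : exists p, `[< has_pmd R G p >].
Proof. by exists #|edges G|; apply/asboolP; apply: has_pmd_edges. Qed.

Definition pmd (R : realType) (G : sgraph) : nat := ex_minn (ex_pmd R G).

(* Main.v *)
Require Import Defs.
From mathcomp Require Import all_boot all_order all_algebra.
From mathcomp Require Import boolp reals.
From mathcomp Require Import zify.
Set Implicit Arguments.
Unset Strict Implicit.
Unset Printing Implicit Defensive.
Import Order.TTheory GRing.Theory Num.Theory.

(**
A bipartite graph with sides [A] and [B] is the set [E] of its edges, a
subset of [A * B].  Given a matching [M] of [E], contract its edges: this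
gives a digraph on [M], with an arc from [e] to [f] when [E] joins the [A]-end
of [e] to the [B]-end of [f].  If a set of edges of [M] induces an acyclic
subdigraph, it is a positive matching, because a topological ordering provides
the weights ([acyclic_positive]).  So a matching splits into [k] successive
positive matchings as soon as its contracted digraph has an acyclic
[k]-colouring, and such a colouring is found greedily: a vertex that receives
a colour used by none of its coloured out-neighbours closes no monochromatic
cycle.

The bound [C(d, 2) + 2] is proved for all [d]-regular [E] by induction on [d]
([biregular_decomposable]).  Components can be treated one at a time, since
decompositions of vertex-disjoint graphs run in parallel ([decomposableU]); so
let [E] be connected, with [d >= 2].  By Hall's theorem [E] has a perfect
matching [M], whose contracted digraph has all out-degrees equal to [d - 1].
The end [z] of a longest directed path has all its out-neighbours on the path,
so there is a directed cycle containing [z] and all its out-neighbours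
([exists_dicycle]).

- If the cycle misses a vertex of [M], an argument in the style of Brooks'
  theorem colours [M] with only [d - 1] colours ([brooks_coloring]).  Some
  vertex [y] of the cycle has an out-neighbour [u] off the cycle, while the
  vertex [x] that follows [y] has none.  Colour everything off the cycle
  greedily, give [x] the colour of [u], and go round the cycle from [x] to
  [y]: each vertex before [y] still has an uncoloured out-neighbour, and [y]
  has two out-neighbours of the same colour.  Removing [M] thus costs [d - 1]
  positive matchings and leaves a [(d - 1)]-regular graph, and
  [C(d - 1, 2) + (d - 1) = C(d, 2)].

- If the cycle passes through all of [M], then [M] together with the edges
  followed by the cycle is a Hamiltonian cycle of [E].  Spend one positive
  matching on a single edge of [M]; a Hamiltonian path remains, together with
  a [(d - 2)]-regular graph [Q].  Remove perfect matchings of [Q] one after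
  the other.  As long as the path is there, the current graph of maximum
  degree [j] is connected and not [j]-regular, hence degenerate enough for
  [j - 1] colours to suffice ([decomposable_stage]).  The path itself costs
  two matchings, and [1 + (d - 1) + ... + 2 + 1 + 1 = C(d, 2) + 2]
  ([decomposable_path], [decomposable_hamiltonian]).
*)

(** * Positive matchings from acyclic sets of matching edges *)

Definition row_of (A B : finType) (E : {set A * B}) (a : A) : {set B} :=
  [set b | (a, b) \in E].

Definition col_of (A B : finType) (E : {set A * B}) (b : B) : {set A} :=
  [set a | (a, b) \in E].

Definition matching (A B : finType) (M : {set A * B}) : Prop :=
  {in M &, forall e f, e.1 = f.1 \/ e.2 = f.2 -> e = f}.

(** The digraph obtained by contracting the edges of a matching, which are
its vertices. *)
Definition arc (A B : finType) (E : {set A * B}) : rel (A * B) :=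
  [rel e f | (f != e) && ((e.1, f.2) \in E)].

Definition sink (A B : finType) (E S : {set A * B}) (e : A * B) : Prop :=
  e \in S /\ {in S, forall f, ~~ arc E e f}.

(** Stated through sinks, so that enlarging an acyclic set by one vertex only
requires looking at the sets that contain this vertex. *)
Definition acyclic (A B : finType) (E M : {set A * B}) : Prop :=
  forall S : {set A * B}, S \subset M -> S != set0 -> exists e, sink E S e.

(** Integer weights, one function per side; they are cast to the reals only
when returning to [positive_matching]. *)
Definition positive (A B : finType) (E M : {set A * B}) : Prop :=
  [/\ M \subset E, matching M &
      exists wa : A -> int, exists wb : B -> int,
        {in E, forall e, if e \in M then (0 < wa e.1 + wb e.2)%R
                         else (wa e.1 + wb e.2 < 0)%R}].

(** A decomposition into [p] parts, encoded by the function that maps an edge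
to the index of its part: at step [i], the edges of index at least [i] are
left.  Parts may be empty, and the condition for [i >= p] holds trivially, so
that [p] can be increased freely. *)
Definition decomposable (A B : finType) (p : nat) (E : {set A * B}) : Prop :=
  exists c : A * B -> nat, {in E, forall e, c e < p} /\
    forall i, positive [set e in E | i <= c e] [set e in E | c e == i].

Lemma matchingS (A B : finType) (M N : {set A * B}) :
  N \subset M -> matching M -> matching N.
Proof. by move=> /subsetP s m e f /s eM /s fM; exact: m. Qed.

Lemma acyclicS (A B : finType) (E F M : {set A * B}) :
  F \subset E -> acyclic E M -> acyclic F M.
Proof.
move=> /subsetP FE ac S SM S0; have [e [eS sk]] := ac S SM S0.
exists e; split=> // f /sk; apply: contra => /andP[fe /FE efE].
by rewrite /arc /= fe efE.
Qed.

(** Repeatedly removing a sink yields a topological ordering. *)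
Lemma acyclic_rank (A B : finType) (E M : {set A * B}) :
  acyclic E M ->
  exists h : A * B -> nat, {in M &, forall e f, arc E e f -> h f < h e}.
Proof.
elim: {M}_.+1 {-2}M (ltnSn #|M|) => // n IH M.
have [-> _ _|M0 leM ac] := eqVneq M set0.
  by exists (fun=> 0) => e f; rewrite inE.
have [e [eM sk]] := ac M (subxx _) M0.
have [||h hP] := IH (M :\ e).
- by move: leM; rewrite (cardsD1 e M) eM add1n ltnS.
- by move=> S SM; apply: ac; apply: subset_trans SM _; apply: subsetDl.
exists (fun x => if x == e then 0 else (h x).+1) => x y xM yM xy.
have [xe|xe] := eqVneq x e; first by case/negP: (sk y yM); rewrite -xe.
have [//|ye] := eqVneq y e; rewrite ltnS; apply: hP => //.
  by rewrite !inE xe.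
by rewrite !inE ye.
Qed.

(** With a topological rank [h], the ends of [e \in M] get weights [- 2 h e]
and [2 h e + 1]: their sum is [1], while an edge of [E] leading from [e] to
[f] has weight [2 h f - 2 h e + 1 < 0].  The vertices that [M] does not cover
get a weight so negative that every edge at them is negative. *)
Lemma acyclic_positive (A B : finType) (E M : {set A * B}) :
  M \subset E -> matching M -> acyclic E M -> positive E M.
Proof.
move=> ME mM /acyclic_rank[h hP]; split=> //.
pose K := \max_(e in M) h e.
have hK e : e \in M -> h e <= K by move=> eM; exact: leq_bigmax_cond.
pose wa a : int :=
  if [pick e in M | e.1 == a] is Some e then (- Posz (h e).*2)%R
  else (- Posz (K.*2 + 2)%N)%R.
pose wb b : int :=
  if [pick e in M | e.2 == b] is Some e then Posz ((h e).*2 + 1)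
  else (- Posz (K.*2 + 2)%N)%R.
exists wa, wb => -[a b] abE /=; rewrite /wa /wb.
case: pickP => [e /andP[eM /eqP ea]|noa]; last first.
  case: ifP => [abM|_]; first by have := noa (a, b); rewrite abM eqxx.
  case: pickP => [f /andP[/hK fK _]|_]; lia.
case: pickP => [f /andP[fM /eqP fb]|nob]; last first.
  case: ifP => [abM|_]; first by have := nob (a, b); rewrite abM eqxx.
  by have := hK _ eM; lia.
case: ifP => [abM|abM].
  have -> : e = (a, b) by apply: mM => //; left.
  have -> : f = (a, b) by apply: mM => //; right.
  lia.
suff : h f < h e by lia.
apply: hP => //; rewrite /arc /= ea fb abE andbT.
by apply: contraFneq abM => fe; rewrite -ea -fb fe -surjective_pairing -fe.
Qed.

(** The graphs share no vertex, so the two weightings can be glued. *)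
Lemma positiveU (A B : finType) (E F M N : {set A * B}) :
  positive E M -> positive F N ->
  {in E & F, forall e f, e.1 != f.1 /\ e.2 != f.2} ->
  positive (E :|: F) (M :|: N).
Proof.
move=> [ME mM [wa [wb wP]]] [NF mN [va [vb vP]]] dis; split.
- exact: setUSS.
- move: (subsetP ME) (subsetP NF) => {}ME {}NF e f.
  rewrite !inE => /orP[eM|eN] /orP[fM|fN] ef.
  + exact: mM.
  + by have [/eqP ? /eqP ?] := dis _ _ (ME _ eM) (NF _ fN); case: ef.
  + have [/eqP d1 /eqP d2] := dis _ _ (ME _ fM) (NF _ eN).
    by case: ef => /esym.
  + exact: mN.
exists (fun a => if [exists e in E, e.1 == a] then wa a else va a).
exists (fun b => if [exists e in E, e.2 == b] then wb b else vb b).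
move=> e eEF.
have [eE|eE] := boolP (e \in E).
  have -> : [exists f in E, f.1 == e.1] by apply/fintype.existsP; exists e; rewrite eE /=.
  have -> : [exists f in E, f.2 == e.2] by apply/fintype.existsP; exists e; rewrite eE /=.
  have eN : e \notin N.
    apply: contraPN (eqxx e.1) => /(subsetP NF) eF.
    by have [/negP] := dis _ _ eE eF.
  by rewrite inE (negPf eN) orbF; apply: wP.
have eF : e \in F by move: eEF; rewrite inE (negPf eE).
have -> : [exists f in E, f.1 == e.1] = false.
  apply/fintype.existsP => -[f /andP[fE /eqP fe]].
  by have [/eqP] := dis _ _ fE eF.
have -> : [exists f in E, f.2 == e.2] = false.
  apply/fintype.existsP => -[f /andP[fE /eqP fe]].
  by have [_ /eqP] := dis _ _ fE eF.
have eM : e \notin M by apply: contra eE; apply: (subsetP ME).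
by rewrite inE (negPf eM); apply: vP.
Qed.

Lemma decomposable_leq (A B : finType) (p q : nat) (E : {set A * B}) :
  p <= q -> decomposable p E -> decomposable q E.
Proof.
move=> pq [c [cp cP]]; exists c; split=> // e eE.
exact: leq_trans (cp e eE) pq.
Qed.

Lemma acyclic0 (A B : finType) (E : {set A * B}) : acyclic E set0.
Proof. by move=> S; rewrite subset0 => /eqP->; rewrite eqxx. Qed.

Lemma decomposable0 (A B : finType) : decomposable 0 (set0 : {set A * B}).
Proof.
exists (fun=> 0); split=> [e|i]; first by rewrite inE.
rewrite (_ : [set _ in _ | _ == _] = set0); last by apply/setP => e; rewrite !inE.
apply: acyclic_positive (acyclic0 _); first exact: sub0set.
by move=> e f; rewrite inE.
Qed.

Lemma decomposableU (A B : finType) (p : nat) (E F : {set A * B}) :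
  {in E & F, forall e f, e.1 != f.1 /\ e.2 != f.2} ->
  decomposable p E -> decomposable p F -> decomposable p (E :|: F).
Proof.
move=> dis [c [cp cP]] [d [dp dP]].
have FnE e : e \in F -> e \notin E.
  move=> eF; apply: contraPN (eqxx e.1) => eE.
  by have [/negP] := dis _ _ eE eF.
exists (fun e => if e \in E then c e else d e); split=> [e|i].
  by rewrite inE; case: ifP => [/cp //|_ /dp].
have -> : [set e in E :|: F | i <= (if e \in E then c e else d e)] =
    [set e in E | i <= c e] :|: [set e in F | i <= d e].
  apply/setP => e; rewrite !inE; case: (boolP (e \in F)) => [/FnE/negPf->//|_].
  by rewrite /= !orbF; case: (e \in E).
have -> : [set e in E :|: F | (if e \in E then c e else d e) == i] =
    [set e in E | c e == i] :|: [set e in F | d e == i].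
  apply/setP => e; rewrite !inE; case: (boolP (e \in F)) => [/FnE/negPf->//|_].
  by rewrite /= !orbF; case: (e \in E).
apply: positiveU => // e f; rewrite !inE => /andP[eE _] /andP[fF _].
exact: dis.
Qed.

(** * Acyclic colourings of the contracted digraph *)

Definition proper_coloring (A B : finType) (E Z : {set A * B}) (k : nat)
    (c : A * B -> nat) : Prop :=
  {in Z, forall e, c e < k} /\
  forall i, acyclic E [set e in Z | c e == i].

(** The colour classes of [M] are removed first; deleting edges only makes it
easier for the later classes to be acyclic. *)
Lemma decomposable_colored (A B : finType) (k q : nat) (E M : {set A * B}) c :
  M \subset E -> matching M -> proper_coloring E M k c ->
  decomposable q (E :\: M) -> decomposable (k + q) E.
Proof.
move=> ME mM [ck cP] [d [dq dP]].
exists (fun e => if e \in M then c e else k + d e); split=> [e eE|i].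
  case: ifP => [/ck|eM]; first lia.
  by rewrite ltn_add2l dq // inE eM.
have [ik|ki] := ltnP i k.
  have -> : [set e in E | (if e \in M then c e else k + d e) == i] =
      [set e in M | c e == i].
    apply/setP => e; rewrite !inE; case: ifP => eM.
      by rewrite (subsetP ME _ eM).
    by apply/andP => -[_ /eqP]; lia.
  apply: acyclic_positive.
  - apply/subsetP => e; rewrite !inE => /andP[eM /eqP ce].
    by rewrite (subsetP ME _ eM) eM ce leqnn.
  - by apply: matchingS mM; apply/subsetP => e; rewrite inE => /andP[].
  - by apply: acyclicS (cP i); apply/subsetP => e; rewrite inE => /andP[].
have := dP (i - k); congr (positive _ _); apply/setP => e; rewrite !inE.
  case: (boolP (e \in M)) => [/[dup] eM /ck cek /=|eM].
    by apply/esym/andP => -[_]; lia.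
  by rewrite /= leq_subLR.
case: (boolP (e \in M)) => [/[dup] eM /ck cek /=|eM].
  by apply/esym/andP => -[_ /eqP]; lia.
by rewrite /=; congr (_ && _); apply/eqP/eqP; lia.
Qed.

Definition outs (A B : finType) (E Z : {set A * B}) (e : A * B) :=
  [set f in Z | arc E e f].

(** In a set of colour [x] that contains [v], the vertex [v] is itself a sink:
this is why only out-neighbours restrict the choice of a colour. *)
Lemma proper_coloring_extend (A B : finType) (E Z : {set A * B}) k c v x :
  proper_coloring E Z k c -> v \notin Z -> x < k ->
  {in outs E Z v, forall f, c f != x} ->
  proper_coloring E (v |: Z) k (fun e => if e == v then x else c e).
Proof.
move=> [ck cP] vZ xk xout; split=> [e|i].
  by rewrite in_setU1; case: eqP => //= _ /ck.
move=> S SZ S0; have [vS|vS] := boolP (v \in S); last first.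
  apply: (cP i) => //; apply/subsetP => e eS; have := subsetP SZ e eS.
  rewrite !inE; case: (eqVneq e v) => //= ev.
  by rewrite -ev eS in vS.
have := subsetP SZ v vS; rewrite !inE eqxx /= => /eqP xi.
exists v; split=> // f fS; apply/negP => vf.
have := subsetP SZ f fS; rewrite !inE.
have /andP[/negPf fv _] := vf; rewrite fv /= => /andP[fZ /eqP cf].
by have := xout f; rewrite inE fZ vf cf xi eqxx => /(_ isT).
Qed.

(** It is the number of colours on [W] that matters, not the size of [W]: the
last vertex in [brooks_coloring] has as many out-neighbours as there are
colours. *)
Lemma free_color (A B : finType) (W : {set A * B}) (c : A * B -> nat) k :
  #|[set (inord (c f) : 'I_k.+1) | f in W]| < k.+1 ->
  {in W, forall f, c f < k.+1} ->
  exists2 x, x < k.+1 & {in W, forall f, c f != x}.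
Proof.
move=> lt cW; have : exists x, x \notin [set (inord (c f) : 'I_k.+1) | f in W].
  apply/fintype.existsP; rewrite -negb_forall; apply/negP => /fintype.forallP all.
  suff : #|[set (inord (c f) : 'I_k.+1) | f in W]| = k.+1 by lia.
  by rewrite -[RHS]card_ord -cardsT; apply: eq_card => x; rewrite all inE.
move=> [x xW]; exists x => // f fW; apply: contra xW => /eqP cx.
by apply/imsetP; exists f; rewrite // cx inord_val.
Qed.

Lemma extend_few (A B : finType) (E Z : {set A * B}) k c v :
  proper_coloring E Z k c -> v \notin Z -> #|outs E Z v| < k ->
  exists2 c', proper_coloring E (v |: Z) k c' & {in Z, c' =1 c}.
Proof.
case: k => // k pc vZ lt.
have [||x xk xP] := @free_color _ _ (outs E Z v) c k.
- by apply: leq_ltn_trans lt; apply: leq_imset_card.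
- by move=> f; rewrite inE => /andP[/pc.1].
exists (fun e => if e == v then x else c e).
  exact: proper_coloring_extend.
by move=> f fZ; case: eqP => // fv; rewrite -fv fZ in vZ.
Qed.

Lemma degenerate_coloring (A B : finType) (E Z : {set A * B}) k :
  (forall S : {set A * B}, S \subset Z -> S != set0 ->
     exists2 e, e \in S & #|outs E S e| < k) ->
  exists c, proper_coloring E Z k c.
Proof.
elim: {Z}_.+1 {-2}Z (ltnSn #|Z|) => // n IH Z.
have [-> _ _|Z0 leZ dg] := eqVneq Z set0.
  exists (fun=> 0); split=> [e|i]; first by rewrite inE.
  rewrite (_ : [set _ in _ | _] = set0); first exact: acyclic0.
  by apply/setP => e; rewrite !inE.
have [e eZ lt] := dg Z (subxx _) Z0.
have [||c pc] := IH (Z :\ e).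
- by move: leZ; rewrite (cardsD1 e Z) eZ add1n ltnS.
- by move=> S SZ; apply: dg; apply: subset_trans SZ _; apply: subsetDl.
have [||c' pc' _] := extend_few (v := e) pc.
- by rewrite !inE eqxx.
- apply: leq_ltn_trans lt; apply: subset_leq_card; apply/subsetP => f.
  by rewrite !inE => /andP[/andP[_ ->] ->].
by exists c'; rewrite setD1K in pc'.
Qed.

(** * Degrees, saturated subgraphs and perfect matchings *)

(** [C] has degree [j] at each vertex of [E] that is not isolated; for [j = 1]
this is a perfect matching, up to isolated vertices. *)
Definition factor (A B : finType) (j : nat) (E C : {set A * B}) : Prop :=
  C \subset E /\
  {in E, forall e, #|row_of C e.1| = j /\ #|col_of C e.2| = j}.

(** Isolated vertices are allowed, so that a union of components of a regular
graph is again a regular graph on the same vertex types. *)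
Definition biregular (A B : finType) (d : nat) (E : {set A * B}) : Prop :=
  factor d E E.

Definition max_degree_leq (A B : finType) (d : nat) (E : {set A * B}) : Prop :=
  (forall a, #|row_of E a| <= d) /\ (forall b, #|col_of E b| <= d).

(** A saturated [F] is a union of connected components of [E]. *)
Definition saturated (A B : finType) (E F : {set A * B}) : Prop :=
  F \subset E /\
  {in F & E, forall e f, e.1 = f.1 \/ e.2 = f.2 -> f \in F}.

Definition regular_component_free (A B : finType) (d : nat)
    (E : {set A * B}) : Prop :=
  forall F, saturated E F -> biregular d F -> F = set0.

Definition nbrs (A B : finType) (E : {set A * B}) (S : {set A}) : {set B} :=
  \bigcup_(a in S) row_of E a.

Lemma card_rows (A B : finType) (E : {set A * B}) (S : {set A}) :
  #|[set e in E | e.1 \in S]| = \sum_(a in S) #|row_of E a|.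
Proof.
under [RHS]eq_bigr => a _ do rewrite -sum1_card.
rewrite -sum1_card pair_big_dep /=; apply: eq_bigl => -[a b].
by rewrite !inE andbC.
Qed.

Lemma card_cols (A B : finType) (E : {set A * B}) (S : {set B}) :
  #|[set e in E | e.2 \in S]| = \sum_(b in S) #|col_of E b|.
Proof.
under [RHS]eq_bigr => b _ do rewrite -sum1_card.
rewrite (exchange_big_dep predT) //= -sum1_card pair_big_dep /=.
by apply: eq_bigl => -[a b]; rewrite !inE andbC.
Qed.

Lemma matching_inj1 (A B : finType) (M : {set A * B}) :
  matching M -> {in M &, injective fst}.
Proof. by move=> mM e f eM fM ef; apply: mM => //; left. Qed.

Lemma matching_inj2 (A B : finType) (M : {set A * B}) :
  matching M -> {in M &, injective snd}.
Proof. by move=> mM e f eM fM ef; apply: mM => //; right. Qed.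

Lemma sum_eq_bound (I : finType) (S : {set I}) (f : I -> nat) (d : nat) :
  {in S, forall i, f i <= d} -> d * #|S| <= \sum_(i in S) f i ->
  {in S, forall i, f i = d}.
Proof.
move=> fd le.
have lf i : i \in S -> f i <= d ?= iff (f i == d).
  by move=> iS; split; rewrite ?fd.
have := leqif_sum lf; rewrite sum_nat_const mulnC => -[le' eq].
have : \sum_(i in S) f i == d * #|S| by rewrite eqn_leq le' le.
by rewrite eq => /fintype.forallP all i iS; apply/eqP; move: (all i); rewrite iS.
Qed.

(** The reason why greedy colouring works below the maximum degree [d].  If
every vertex of [S] has [d - 1] out-neighbours in [S], then, counting its own
matching edge, each of the [A]-ends of [S] has [d] neighbours, all among the
[B]-ends of [S].  These are [d * #|S|] edges, and the [B]-ends have no room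
for more: the ends of [S] span a [d]-regular union of components. *)
Lemma saturated_of_outdegree (A B : finType) (d : nat)
    (E M S : {set A * B}) :
  max_degree_leq d E -> matching M -> M \subset E -> S \subset M ->
  {in S, forall e, d <= #|outs E S e|.+1} ->
  saturated E [set e in E | e.1 \in [set f.1 | f in S]] /\
  biregular d [set e in E | e.1 \in [set f.1 | f in S]].
Proof.
move=> [rd cd] mM ME SM outS; set F := [set _ in _ | _].
have mS := matchingS SM mM.
have rowS e : e \in S -> row_of E e.1 \subset [set f.2 | f in S] /\
    #|row_of E e.1| = d.
  move=> eS; pose W := [set f.2 | f in e |: outs E S e].
  have WE : W \subset row_of E e.1.
    apply/subsetP => b /imsetP[f fW ->]; move: fW; rewrite !inE.
    case/orP => [/eqP->|/andP[_ /andP[_]]] //.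
    by rewrite -surjective_pairing (subsetP ME) // (subsetP SM).
  have Wd : d <= #|W|.
    rewrite card_in_imset; last first.
      by move=> f g; rewrite !inE => fW gW; apply: (matching_inj2 mS);
        [case/orP: fW => [/eqP->|/andP[]] | case/orP: gW => [/eqP->|/andP[]]].
    by rewrite cardsU1 !inE /arc /= eqxx /= andbF; exact: outS.
  have -> : row_of E e.1 = W.
    by apply/esym/eqP; rewrite eqEcard WE (leq_trans (rd _)).
  split; last by apply/eqP; rewrite eqn_leq Wd (leq_trans (subset_leq_card WE)).
  by apply: imsetS; apply/subsetP => f; rewrite !inE => /orP[/eqP->|/andP[]].
pose F' := [set e in E | e.2 \in [set f.2 | f in S]].
have FF' : F \subset F'.
  apply/subsetP => -[a b]; rewrite !inE /= => /andP[abE /imsetP[f fS af]].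
  have [/subsetP sub _] := rowS _ fS.
  by rewrite abE; apply: sub; rewrite inE -af.
have cF : #|F| = d * #|S|.
  rewrite card_rows (eq_bigr (fun=> d)); last first.
    by move=> a /imsetP[e eS ->]; case: (rowS _ eS).
  by rewrite sum_nat_const mulnC (card_in_imset (matching_inj1 mS)).
have colS : {in [set f.2 | f in S], forall b, #|col_of E b| = d}.
  apply: sum_eq_bound => [b _|]; first exact: cd.
  by rewrite (card_in_imset (matching_inj2 mS)) -cF -card_cols subset_leq_card.
have eFF' : F = F'.
  apply/eqP; rewrite eqEcard FF' /= cF card_cols (eq_bigr (fun=> d)) //.
  by rewrite sum_nat_const mulnC (card_in_imset (matching_inj2 mS)).
have satF : saturated E F.
  split; first by apply/subsetP => e; rewrite inE => /andP[].
  move=> e f eF fE [ef|ef].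
    by move: eF; rewrite !inE fE -ef => /andP[].
  by move: eF; rewrite eFF' !inE fE -ef => /andP[].
split=> //; split=> // e eF; split.
  have -> : row_of F e.1 = row_of E e.1.
    apply/setP => b; rewrite !inE /=; move: eF; rewrite inE => /andP[_ ->].
    by rewrite andbT.
  by move: eF; rewrite inE => /andP[_ /imsetP[f fS ->]]; case: (rowS _ fS).
have -> : col_of F e.2 = col_of E e.2.
  apply/setP => a; rewrite eFF' !inE /=; move: eF; rewrite eFF' inE.
  by move=> /andP[_ ->]; rewrite andbT.
by apply: colS; move: eF; rewrite eFF' inE => /andP[].
Qed.

(** Without a [k.+1]-regular component, every nonempty set of vertices of the
contracted digraph has one with fewer than [k] out-neighbours in this set. *)
Lemma decomposable_stage (A B : finType) (k q : nat) (E M : {set A * B}) :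
  max_degree_leq k.+1 E -> regular_component_free k.+1 E ->
  M \subset E -> matching M ->
  decomposable q (E :\: M) -> decomposable (k + q) E.
Proof.
move=> dE rE ME mM dq.
suff [c pc] : exists c, proper_coloring E M k c.
  exact: decomposable_colored pc dq.
apply: degenerate_coloring => S SM /set0Pn[e eS].
have [/fintype.existsP[f /andP[fS lt]]|] :=
  boolP [exists f in S, #|outs E S f| < k]; first by exists f.
rewrite negb_exists => /fintype.forallP all.
have [f fS|sat reg] := saturated_of_outdegree dE mM ME SM.
  by have := all f; rewrite fS /= ltnS -leqNgt.
have /setP/(_ e) := rE _ sat reg.
by rewrite !inE (subsetP ME) ?(subsetP SM) // imset_f.
Qed.

(** Hall's theorem, by Rado's argument: in a minimal edge set that satisfies
Hall's condition each vertex of [X] has a single neighbour.  If [a] had two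
neighbours [b] and [b'], deleting either edge would violate the condition, say
on [a |: T] and on [a |: T'], with neighbourhoods [Y] and [Y'].  As [Y :|: Y']
contains the neighbours of [a |: (T :|: T')] and [Y :&: Y'] those of
[T :&: T'], submodularity of cardinals gives a contradiction. *)
Lemma hall_matching (A B : finType) (E : {set A * B}) (X : {set A}) :
  (forall S : {set A}, S \subset X -> #|S| <= #|nbrs E S|) ->
  exists M : {set A * B}, [/\ M \subset E, matching M & [set e.1 | e in M] = X].
Proof.
move=> hE.
pose P := [pred F : {set A * B} |
  (F \subset E) && [forall S : {set A}, (S \subset X) ==> (#|S| <= #|nbrs F S|)]].
have /ex_minset[F /minsetP[/andP[FE /fintype.forallP hF] Fmin]] : exists F, P F.
  by exists E; rewrite /P /= subxx; apply/fintype.forallP => S; apply/implyP/hE.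
have {}hF (S : {set A}) : S \subset X -> #|S| <= #|nbrs F S|.
  by move=> SX; have /implyP := hF S; apply.
have inN (G : {set A * B}) (S : {set A}) a b : a \in S -> (a, b) \in G -> b \in nbrs G S.
  by move=> aS abG; apply/bigcupP; exists a; rewrite ?inE.
have viol a b : a \in X -> (a, b) \in F ->
    exists T : {set A}, [/\ T \subset X, a \notin T &
      exists Y : {set B}, [/\ #|Y| <= #|T|, nbrs F T \subset Y &
                       row_of F a :\ b \subset Y]].
  move=> aX abF.
  have /negP : ~~ P (F :\ (a, b)).
    apply/negP => /Fmin/(_ (subsetDl _ _))/setP/(_ (a, b)).
    by rewrite abF !inE eqxx.
  rewrite /P /= (subset_trans (subsetDl _ _) FE) /= => /negP.
  rewrite negb_forall => /fintype.existsP[S].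
  rewrite negb_imply -ltnNge => /andP[SX lt].
  have inY x y : x \in S -> (x, y) \in F -> (x, y) != (a, b) ->
      y \in nbrs (F :\ (a, b)) S.
    by move=> xS xyF ne; apply: (inN _ _ x); rewrite // !inE ne.
  have aS : a \in S.
    apply: contraLR lt => aS; rewrite -leqNgt (leq_trans (hF S SX)) //.
    apply/subset_leq_card/subsetP => y /bigcupP[x xS]; rewrite inE => xyF.
    apply: (inY x) => //; apply: contra aS => /eqP[<- _] //.
  exists (S :\ a); split.
  - exact: subset_trans (subsetDl _ _) SX.
  - by rewrite !inE eqxx.
  exists (nbrs (F :\ (a, b)) S); split.
  - by move: lt; rewrite [#|S|](cardsD1 a) aS.
  - apply/subsetP => y /bigcupP[x]; rewrite !inE => /andP[xa xS] xyF.
    by apply: (inY x) => //; apply: contra xa => /eqP[<- _].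
  - apply/subsetP => y; rewrite !inE => /andP[yb ayF].
    by apply: (inY a) => //; apply: contra yb => /eqP[<-].
have row1 a b b' : a \in X -> (a, b) \in F -> (a, b') \in F -> b = b'.
  move=> aX abF ab'F; apply/eqP/negPn/negP => bb'.
  have [T [TX aT [Y [YT NY rY]]]] := viol a b aX abF.
  have [T' [TX' aT' [Y' [YT' NY' rY']]]] := viol a b' aX ab'F.
  (* The edge to [b] survives in the graph that defines [Y'], and the other
     edges at [a] in the one that defines [Y]. *)
  have h1 : #|a |: (T :|: T')| <= #|Y :|: Y'|.
    apply: leq_trans (hF _ _) (subset_leq_card _).
      by apply/subsetP => x; rewrite !inE => /orP[/eqP->|/orP[/(subsetP TX)|/(subsetP TX')]].
    apply/subsetP => y /bigcupP[x]; rewrite !inE => /orP[/eqP->|/orP[xT|xT]] xyF.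
    - have [yb|yb] := eqVneq y b.
        by rewrite (subsetP rY') ?orbT // !inE yb bb'.
      by rewrite (subsetP rY) // !inE yb.
    - by rewrite (subsetP NY) //; apply: (inN _ _ x).
    - by rewrite (subsetP NY') ?orbT //; apply: (inN _ _ x).
  have h2 : #|T :&: T'| <= #|Y :&: Y'|.
    apply: leq_trans (hF _ _) (subset_leq_card _).
      exact: subset_trans (subsetIl _ _) TX.
    apply/subsetP => y /bigcupP[x]; rewrite !inE => /andP[xT xT'] xyF.
    by rewrite (subsetP NY) ?(subsetP NY') //; apply: (inN _ _ x).
  move: h1; rewrite cardsU1 inE negb_or aT aT' /= => h1.
  have := cardsUI T T'; have := cardsUI Y Y'.
  move: h1 h2 YT YT'; lia.
exists [set e in F | e.1 \in X]; split.
- by apply/subsetP => e; rewrite inE => /andP[/(subsetP FE)].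
- move=> [a b] [a' b']; rewrite !inE /= => /andP[abF aX] /andP[abF' aX'].
  case=> [eqa|eqb].
    by move: abF' aX'; rewrite -eqa => abF' _; rewrite (row1 a b b').
  rewrite -eqb in abF' *; congr (_, _); apply/eqP/negPn/negP => aa'.
  have : #|[set a; a']| <= #|nbrs F [set a; a']|.
    by apply: hF; rewrite subUset !sub1set aX.
  rewrite cards2 aa' leqNgt => /negP; apply.
  rewrite /= ltnS -(cards1 b); apply/subset_leq_card/subsetP => y /bigcupP[x].
  rewrite !inE => /orP[]/eqP-> xy; apply/eqP.
    exact: (row1 a).
  exact: (row1 a').
- apply/setP => a; apply/imsetP/idP => [[e]|aX].
    by rewrite inE => /andP[_ eX ->].
  have := hF [set a]; rewrite sub1set aX cards1 => /(_ isT).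
  rewrite card_gt0 => /set0Pn[b /bigcupP[x]]; rewrite !inE => /eqP-> abF.
  by exists (a, b); rewrite // inE abF.
Qed.

Lemma factor1_matching (A B : finType) (E M : {set A * B}) :
  factor 1 E M -> matching M.
Proof.
move=> [ME fM] [a b] [a' b'] eM fM'.
have [r1 c1] := fM _ (subsetP ME _ eM); case=> /= [eqa|eqb].
  have /eqP/cards1P[x rx] := r1.
  have : b \in row_of M a by rewrite inE.
  have : b' \in row_of M a by rewrite inE eqa.
  by rewrite rx !inE eqa => /eqP-> /eqP->.
have /eqP/cards1P[x rx] := c1.
have : a \in col_of M b by rewrite inE.
have : a' \in col_of M b by rewrite inE eqb.
by rewrite rx !inE eqb => /eqP-> /eqP->.
Qed.

(** Double counting gives Hall's condition; counting again, the [B]-ends of the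
matching already carry all the edges of [E]. *)
Lemma biregular_perfect_matching (A B : finType) (d : nat) (E : {set A * B}) :
  biregular d.+1 E -> exists M : {set A * B}, factor 1 E M.
Proof.
move=> [_ rE]; pose X := [set e.1 | e in E].
have rX a : a \in X -> #|row_of E a| = d.+1.
  by case/imsetP => e /rE[re _] ->.
have cX b : #|col_of E b| <= d.+1.
  have [->|/set0Pn[a]] := eqVneq (col_of E b) set0; first by rewrite cards0.
  by rewrite inE => /rE[_ /= ->].
have cS (S : {set A}) : S \subset X -> #|[set e in E | e.1 \in S]| = d.+1 * #|S|.
  move=> /subsetP SX; rewrite card_rows (eq_bigr (fun=> d.+1)).
    by rewrite sum_nat_const mulnC.
  by move=> a /SX/rX.
have cT (T : {set B}) : #|[set e in E | e.2 \in T]| <= d.+1 * #|T|.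
  by rewrite card_cols mulnC -sum_nat_const; apply: leq_sum => b _; exact: cX.
have [S SX|M [ME mM MX]] := @hall_matching _ _ E X.
  rewrite -(leq_pmul2l (ltn0Sn d)) -(cS S SX) (leq_trans _ (cT _)) //.
  apply/subset_leq_card/subsetP => -[a b]; rewrite !inE /= => /andP[abE aS].
  by rewrite abE; apply/bigcupP; exists a; rewrite ?inE.
have colM : [set e in E | e.2 \in [set f.2 | f in M]] = E.
  apply/eqP; rewrite eqEcard; apply/andP; split.
    by apply/subsetP => e; rewrite inE => /andP[].
  have -> : #|E| = d.+1 * #|X|.
    rewrite -(cS X) //; apply: eq_card => e; rewrite inE.
    by case: (boolP (e \in E)) => // eE; rewrite imset_f.
  rewrite card_cols (eq_bigr (fun=> d.+1)); last first.
    by move=> b /imsetP[e /(subsetP ME)/rE[_ ce] ->].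
  by rewrite sum_nat_const mulnC -MX !card_in_imset //;
    [exact: matching_inj2 | exact: matching_inj1].
exists M; split=> // e eE; split.
  have : e.1 \in X by rewrite imset_f.
  rewrite -MX => /imsetP[f fM ->]; apply/eqP/cards1P; exists f.2.
  apply/setP => b; rewrite !inE; apply/idP/eqP => [fbM|->].
    by have <- : (f.1, b) = f by apply: mM => //; left.
  by rewrite -surjective_pairing.
have : e \in [set e in E | e.2 \in [set f.2 | f in M]] by rewrite colM.
rewrite inE => /andP[_ /imsetP[f fM ->]]; apply/eqP/cards1P; exists f.1.
apply/setP => a; rewrite !inE; apply/idP/eqP => [fbM|->].
  by have <- : (a, f.2) = f by apply: mM => //; right.
by rewrite -surjective_pairing.
Qed.

(** * Regular components and Hamiltonian paths *)

Definition connected_edges (A B : finType) (E : {set A * B}) : Prop :=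
  forall F, saturated E F -> F != set0 -> F = E.

Lemma saturated_rows (A B : finType) (E F : {set A * B}) (e : A * B) :
  saturated E F -> e \in F ->
  row_of F e.1 = row_of E e.1 /\ col_of F e.2 = col_of E e.2.
Proof.
move=> [/subsetP FE sF] eF; split; apply/setP => x; rewrite !inE.
  by apply/idP/idP => [/FE//|xE]; apply: (sF e _ eF xE); left.
by apply/idP/idP => [/FE//|xE]; apply: (sF e _ eF xE); right.
Qed.

Lemma saturated_biregular (A B : finType) (d : nat) (E F : {set A * B}) :
  saturated E F -> biregular d E -> biregular d F.
Proof.
move=> sF [_ rE]; split=> // e eF.
have [-> ->] := saturated_rows sF eF.
by apply: rE; apply: (subsetP sF.1).
Qed.

Lemma saturatedD (A B : finType) (E F : {set A * B}) :
  saturated E F -> saturated E (E :\: F).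
Proof.
move=> [FE sF]; split; first exact: subsetDl.
move=> e f; rewrite !inE => /andP[eF eE] fE ef; rewrite fE andbT.
apply: contra eF => fF; apply: (sF f) => //.
by case: ef; [left | right].
Qed.

Lemma biregular_max_degree (A B : finType) (d : nat) (E : {set A * B}) :
  biregular d E -> max_degree_leq d E.
Proof.
move=> [_ rE]; split=> [a|b].
  have [->|/set0Pn[b]] := eqVneq (row_of E a) set0; first by rewrite cards0.
  by rewrite inE => /rE[/= ->].
have [->|/set0Pn[a]] := eqVneq (col_of E b) set0; first by rewrite cards0.
by rewrite inE => /rE[_ /= ->].
Qed.

Lemma matching_max_degree (A B : finType) (M : {set A * B}) :
  matching M -> max_degree_leq 1 M.
Proof.
move=> mM; split=> [a|b]; apply/card_le1_eqP => x y; rewrite !inE => xM yM.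
  by have [] : (a, x) = (a, y) by apply: mM => //; left.
by have [] : (x, b) = (y, b) by apply: mM => //; right.
Qed.

Lemma max_degree_leqU (A B : finType) (i j : nat) (E F : {set A * B}) :
  max_degree_leq i E -> max_degree_leq j F -> max_degree_leq (i + j) (E :|: F).
Proof.
move=> [rE cE] [rF cF]; split=> x.
  have -> : row_of (E :|: F) x = row_of E x :|: row_of F x.
    by apply/setP => y; rewrite !inE.
  by rewrite (leq_trans (leq_card_setU _ _)) ?leq_add.
have -> : col_of (E :|: F) x = col_of E x :|: col_of F x.
  by apply/setP => y; rewrite !inE.
by rewrite (leq_trans (leq_card_setU _ _)) ?leq_add.
Qed.

Lemma factorD (A B : finType) (c d : nat) (E C : {set A * B}) :
  biregular d E -> factor c E C -> biregular (d - c) (E :\: C).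
Proof.
move=> [_ rE] [CE rC]; split=> // e; rewrite inE => /andP[_ eE].
have [re ce] := rE e eE; have [re' ce'] := rC e eE.
have -> : row_of (E :\: C) e.1 = row_of E e.1 :\: row_of C e.1.
  by apply/setP => x; rewrite !inE.
have -> : col_of (E :\: C) e.2 = col_of E e.2 :\: col_of C e.2.
  by apply/setP => x; rewrite !inE.
rewrite !cardsDS ?re ?ce ?re' ?ce' //; apply/subsetP => x; rewrite !inE;
  exact: (subsetP CE).
Qed.

Lemma factorU (A B : finType) (c d : nat) (E C D : {set A * B}) :
  [disjoint C & D] -> factor c E C -> factor d E D ->
  factor (c + d) E (C :|: D).
Proof.
move=> CD [CE rC] [DE rD]; split; first by rewrite subUset CE.
move=> e eE; have [re ce] := rC e eE; have [re' ce'] := rD e eE.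
have -> : row_of (C :|: D) e.1 = row_of C e.1 :|: row_of D e.1.
  by apply/setP => x; rewrite !inE.
have -> : col_of (C :|: D) e.2 = col_of C e.2 :|: col_of D e.2.
  by apply/setP => x; rewrite !inE.
split; [rewrite -re -re' | rewrite -ce -ce']; apply/eqP;
  rewrite (leq_card_setU _ _).2 -setI_eq0; apply/eqP/setP => x; rewrite !inE;
  apply/andP => -[xC]; rewrite (disjointFr CD) //.
Qed.

(** A [(j.+1 + k)]-regular union [F] of components of [P :|: Q] must use up the
degree bounds of both graphs, so that [F :&: P] is a [j.+1]-regular union of
components of [P].  The successor ensures that [F :&: P] is not empty when [F]
is not. *)
Lemma regular_component_freeU (A B : finType) (j k : nat) (P Q : {set A * B}) :
  max_degree_leq j.+1 P -> regular_component_free j.+1 P -> biregular k Q ->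
  regular_component_free (j.+1 + k) (P :|: Q).
Proof.
move=> dP fP /biregular_max_degree dQ F sF [_ rF].
have degP e : e \in F -> #|row_of P e.1| = j.+1 /\ #|col_of P e.2| = j.+1.
  move=> eF; have [] := rF e eF; have [-> ->] := saturated_rows sF eF.
  have -> : row_of (P :|: Q) e.1 = row_of P e.1 :|: row_of Q e.1.
    by apply/setP => x; rewrite !inE.
  have -> : col_of (P :|: Q) e.2 = col_of P e.2 :|: col_of Q e.2.
    by apply/setP => x; rewrite !inE.
  have := (leq_card_setU (row_of P e.1) (row_of Q e.1)).1.
  have := (leq_card_setU (col_of P e.2) (col_of Q e.2)).1.
  have := dP.1 e.1; have := dP.2 e.2; have := dQ.1 e.1; have := dQ.2 e.2.
  lia.
have sFP : saturated P (F :&: P).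
  split=> [|e f]; first exact: subsetIr.
  rewrite !inE => /andP[eF _] fP' ef; rewrite fP' andbT.
  by apply: (sF.2 e) => //; rewrite inE fP'.
have FP0 : F :&: P = set0.
  apply: fP => //; split=> // e eFP.
  have [-> ->] := saturated_rows sFP eFP.
  by apply: degP; move: eFP; rewrite inE => /andP[].
apply/eqP/negPn/negP => /set0Pn[e eF].
have [rP _] := degP e eF.
have /set0Pn[b] : row_of P e.1 != set0 by rewrite -card_gt0 rP.
rewrite inE => bP; have /setP/(_ (e.1, b)) := FP0; rewrite !inE bP andbT.
by move/negP; apply; apply: (sF.2 e) => //; [rewrite inE bP | left].
Qed.

Lemma decomposable_matching (A B : finType) (M : {set A * B}) :
  matching M -> decomposable 1 M.
Proof.
move=> mM; apply: (@decomposable_colored _ _ 1 0 M M (fun=> 0)) => //.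
  split=> // i S SM /set0Pn[e eS]; exists e; split=> // f fS.
  apply/negP => /andP[fe efM]; move/subsetP: SM => SM.
  have eM : e \in M by have := SM e eS; rewrite inE => /andP[].
  have fM : f \in M by have := SM f fS; rewrite inE => /andP[].
  have ee : (e.1, f.2) = e by apply: mM => //; left.
  by case/eqP: fe; apply: mM => //; right; rewrite -[in RHS]ee.
by rewrite setDv; exact: decomposable0.
Qed.

(** The case of interest is a Hamiltonian path [P1 :|: P2], with alternate edges
in [P1] and [P2].  The only property of it that is passed on when [Q] shrinks
is that it has no [2]-regular component. *)
Lemma decomposable_path (A B : finType) (k : nat) (P1 P2 Q : {set A * B}) :
  matching P1 -> matching P2 -> regular_component_free 2 (P1 :|: P2) ->
  [disjoint P1 :|: P2 & Q] -> biregular k Q ->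
  decomposable ('C(k.+2, 2) + 1) (P1 :|: P2 :|: Q).
Proof.
move=> m1 m2 fP; have dP := max_degree_leqU (matching_max_degree m1)
  (matching_max_degree m2).
elim: k Q => [|k IH] Q PQ rQ.
  have -> : Q = set0.
    apply/eqP/negPn/negP => /set0Pn[[a b] abQ].
    have [/eqP] := rQ.2 _ abQ; rewrite cards_eq0 => /eqP/setP/(_ b).
    by rewrite !inE abQ.
  rewrite setU0 binn; apply: (@decomposable_stage _ _ 1 1 _ P2) => //.
    exact: subsetUr.
  apply: decomposable_matching; apply: matchingS m1.
  by apply/subsetP => e; rewrite !inE => /andP[/negPf->]; rewrite orbF.
have [N fN] := biregular_perfect_matching rQ.
have [NQ _] := fN.
rewrite binS bin1 [('C(_, _) + _)%N]addnC -addnA.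
apply: (@decomposable_stage _ _ _ _ _ N).
- have := max_degree_leqU dP (biregular_max_degree rQ).
  by rewrite !addSn !addnS.
- have := regular_component_freeU dP fP rQ.
  by rewrite !addSn.
- by rewrite (subset_trans NQ) ?subsetUr.
- exact: factor1_matching fN.
have -> : (P1 :|: P2 :|: Q) :\: N = P1 :|: P2 :|: (Q :\: N).
  apply/setP => e; rewrite in_setD [in LHS]in_setU [in RHS]in_setU in_setD.
  case: (boolP (e \in N)) => [/(subsetP NQ) eQ|] //=.
  by rewrite orbF (disjointFl PQ eQ).
apply: IH; last by have := factorD rQ fN; rewrite subn1.
by apply: disjointWr PQ; apply: subsetDl.
Qed.

Lemma split_last (T : Type) (a : pred T) (s : seq T) :
  has a s -> exists s1 x s2, [/\ s = s1 ++ x :: s2, a x & ~~ has a s2].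
Proof.
elim: s => //= y s IH; case: (boolP (has a s)) => [/IH|no].
  by move=> [s1 [x [s2 [-> ax n2]]]] _; exists (y :: s1), x, s2.
by rewrite orbF => ay; exists [::], y, s.
Qed.

(** * Directed cycles and Brooks-type colourings *)

(** A directed path that cannot be prolonged ends at a vertex [z] whose
out-neighbours all lie on it; close the path by the arc from [z] to the one
that comes first.  Paths are listed backwards, with [z] at the head. *)
Lemma exists_dicycle (A B : finType) (E M : {set A * B}) :
  M != set0 -> {in M, forall e, outs E M e != set0} ->
  exists p : seq (A * B),
    [/\ uniq p, {subset p <= M}, cycle (arc E) p &
        exists2 z, z \in p & {subset outs E M z <= p}].
Proof.
move=> /set0Pn[e0 e0M] outM.
pose r := [rel e f | arc E f e].
suff: forall n z q, uniq (z :: q) -> {subset z :: q <= M} -> path r z q ->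
   #|M| <= n + size q -> exists p : seq (A * B),
    [/\ uniq p, {subset p <= M}, cycle (arc E) p &
        exists2 z, z \in p & {subset outs E M z <= p}].
  by move=> /(_ #|M| e0 [::]); apply=> //; [move=> x; rewrite inE => /eqP-> | rewrite addn0].
elim=> [|n IH] z q uq qM pq le.
  have /subset_leq_card : z :: q \subset M by apply/subsetP.
  by rewrite (card_uniqP uq) => /leq_trans/(_ le); rewrite add0n ltnn.
have [sub|] := boolP (outs E M z \subset q); last first.
  case/subsetPn=> u; rewrite inE => /andP[uM zu] uq'.
  apply: (IH u (z :: q)); last by rewrite /= addnS -addSn.
  - by rewrite cons_uniq uq andbT inE negb_or uq' andbT; case/andP: zu.
  - by move=> x; rewrite inE => /orP[/eqP->|/qM].
  - by rewrite /= zu.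
have /split_last[q1 [w [q2 [eq zw n2]]]] : has (arc E z) q.
  have /set0Pn[w wo] := outM z (qM z (mem_head _ _)).
  apply/hasP; exists w; first exact: (subsetP sub).
  by move: wo; rewrite inE => /andP[].
have sp : z :: q = rcons (z :: q1) w ++ q2 by rewrite eq /= cat_rcons.
exists (rev (z :: rcons q1 w)); split.
- by rewrite rev_uniq; move: uq; rewrite sp cat_uniq => /andP[].
- by move=> x; rewrite mem_rev => xp; apply: qM; rewrite sp mem_cat xp.
- rewrite rev_cycle /= rcons_path last_rcons /= zw andbT.
  by move: pq; rewrite eq -cat_rcons cat_path => /andP[].
exists z; first by rewrite mem_rev mem_head.
move=> x /[dup] /(subsetP sub) xq; rewrite inE => /andP[_ zx].
move: xq; rewrite mem_rev inE eq -cat_rcons mem_cat => /orP[->|x2]; rewrite ?orbT //.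
by case/hasP: n2; exists x.
Qed.

(** A cycle that meets [P] and its complement enters [P] somewhere; rotate it so
as to start there. *)
Lemma cycle_switch (T : eqType) (r : rel T) (P : pred T) (p : seq T) :
  cycle r p -> has P p -> has (predC P) p ->
  exists x q, [/\ perm_eq (x :: q) p, path r x q, P x, ~~ P (last x q) &
                  r (last x q) x].
Proof.
move=> cp hP /hasP[y yp nPy].
have [i s ps] := rot_to yp.
have hs : has P s by move: hP; rewrite -(has_rot i) ps /= (negPf nPy).
move: ps; case: (split_find hs) => x s1 s2 Px n1; rewrite cat_rcons => ps.
have ps' : x :: s2 ++ y :: s1 = rot (size s1).+1 (rot i p).
  by rewrite ps -cat_cons -[(size s1).+1]/(size (y :: s1)) rot_size_cat.
have : cycle r (x :: s2 ++ y :: s1) by rewrite ps' !rot_cycle.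
rewrite /= rcons_path => /andP[pr lst].
exists x, (s2 ++ y :: s1); split=> //.
  by rewrite ps' !perm_rot.
rewrite last_cat /=; case/lastP: s1 n1 {ps ps' pr lst} => //= s1 w.
by rewrite last_rcons has_rcons negb_or => /andP[].
Qed.

Lemma card_outs (A B : finType) (d : nat) (E M : {set A * B}) (e : A * B) :
  biregular d E -> factor 1 E M -> e \in M -> #|outs E M e|.+1 = d.
Proof.
move=> [_ rE] fM eM; have mM := factor1_matching fM.
have [ME cM] := fM; have eE := subsetP ME _ eM.
have <- : #|row_of E e.1| = d by case: (rE e eE).
have -> : row_of E e.1 = [set f.2 | f in e |: outs E M e].
  apply/setP => b; rewrite inE; apply/idP/imsetP => [ebE|[f]].
    have [_ /eqP/cards1P[a /setP/(_ a)]] := cM _ ebE.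
    rewrite !inE eqxx => abM; exists (a, b); rewrite // !inE /arc /= abM ebE.
    by rewrite andbT orbN.
  rewrite !inE => /orP[/eqP-> ->|/andP[_ /andP[_ efE]] -> //].
  by rewrite -surjective_pairing.
rewrite card_in_imset ?cardsU1 ?inE /arc /= ?eqxx ?andbF //.
by move=> f g; rewrite !inE => fW gW; apply: (matching_inj2 mM);
  [case/orP: fW => [/eqP->|/andP[]] | case/orP: gW => [/eqP->|/andP[]]].
Qed.

(** The connected form of [saturated_of_outdegree]: no proper nonempty set of
vertices contains all the out-neighbours of its members. *)
Lemma connected_outdegree (A B : finType) (d : nat) (E M S : {set A * B}) :
  connected_edges E -> biregular d E -> factor 1 E M -> S \subset M ->
  S != set0 -> {in S, forall e, d <= #|outs E S e|.+1} -> S = M.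
Proof.
move=> cE rE fM SM /set0Pn[e eS] oS; have mM := factor1_matching fM.
have [ME _] := fM.
have [sat _] := saturated_of_outdegree (biregular_max_degree rE) mM ME SM oS.
have eqE := cE _ sat.
apply/eqP; rewrite eqEsubset SM; apply/subsetP => m mM'.
have : m \in [set e in E | e.1 \in [set f.1 | f in S]].
  rewrite eqE ?(subsetP ME) //; apply/set0Pn; exists e.
  by rewrite inE (subsetP ME) ?(subsetP SM) // imset_f.
rewrite inE => /andP[_ /imsetP[f fS mf]].
by have -> : m = f by apply: mM => //; [exact: (subsetP SM) | left].
Qed.

(** Along a directed path, each vertex but the last still has an uncoloured
out-neighbour, its successor, when its turn comes. *)
Lemma path_coloring (A B : finType) (E M Z : {set A * B}) k c w q :
  proper_coloring E Z k c -> Z \subset M ->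
  {in M, forall e, #|outs E M e| <= k} ->
  path (arc E) w q -> uniq (w :: q) -> {subset w :: q <= M} ->
  {in w :: q, forall e, e \notin Z} ->
  exists2 c', proper_coloring E (Z :|: [set e in belast w q]) k c' &
              {in Z, c' =1 c}.
Proof.
move=> + + oM; elim: q w Z c => [|v q IH] w Z c pc ZM pq uq qM qZ.
  by exists c => //; rewrite [X in _ :|: X](_ : _ = set0) ?setU0 //;
    apply/setP => e; rewrite !inE.
have wZ : w \notin Z by apply: qZ; rewrite mem_head.
have vZ : v \notin Z by apply: qZ; rewrite !inE eqxx orbT.
have [/andP[wv pvq] /andP[wvq uvq]] := (pq, uq).
have [|c1 pc1 eq1] := extend_few pc wZ.
  apply: leq_trans (oM w (qM w (mem_head _ _))); apply: proper_card.
  apply/properP; split.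
    by apply/subsetP => f; rewrite !inE => /andP[/(subsetP ZM)-> ->].
  by exists v; rewrite !inE ?(negPf vZ) ?wv ?andbT // qM // !inE eqxx orbT.
have [|x xq|x xq|c2 pc2 eq2] := IH v (w |: Z) c1 pc1 _ pvq uvq.
- by apply/subsetP => x; rewrite !inE => /orP[/eqP->|/(subsetP ZM)//]; apply: qM; exact: mem_head.
- by apply: qM; rewrite inE xq orbT.
- rewrite in_setU1 negb_or (qZ x) ?andbT; last by rewrite inE xq orbT.
  by apply: contraNneq wvq => <-.
exists c2.
  rewrite (_ : _ :|: _ = w |: Z :|: [set e in belast v q]) //.
  by apply/setP => x; rewrite !inE orbCA orbA.
by move=> x xZ; rewrite eq2 ?eq1 // !inE xZ orbT.
Qed.

(** [z] yields a vertex of the cycle without out-neighbours off the cycle, and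
connectedness one with such an out-neighbour since [m] is off the cycle.  At
the place where the cycle passes from the second kind to the first, two
out-neighbours [u] and [x] of a single vertex [y] can get the same colour,
which saves the colour needed for [y]. *)
Lemma brooks_coloring (A B : finType) (k : nat) (E M : {set A * B}) p z m :
  connected_edges E -> biregular k.+2 E -> factor 1 E M ->
  {subset p <= M} -> uniq p -> cycle (arc E) p ->
  z \in p -> {subset outs E M z <= p} -> m \in M -> m \notin p ->
  exists c, proper_coloring E M k.+1 c.
Proof.
move=> cE rE fM pM up cp zp zout mM mp.
have oM e : e \in M -> #|outs E M e| = k.+1.
  by move=> /(card_outs rE fM)[].
pose C := [set e in p]; pose Z0 := M :\: C.
pose P e := outs E M e \subset C.
have CM : C \subset M by apply/subsetP => x; rewrite inE => /pM.
have hP : has P p.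
  by apply/hasP; exists z => //; apply/subsetP => x /zout; rewrite inE.
have hnP : has (predC P) p.
  rewrite has_predC; apply/negP => /allP all.
  have CeM : C = M.
    apply: (connected_outdegree cE rE fM CM).
      by apply/set0Pn; exists z; rewrite inE.
    move=> e eC; rewrite -(oM e (subsetP CM _ eC)) ltnS subset_leq_card //.
    have /subsetP eout : P e by apply: all; rewrite inE in eC.
    apply/subsetP => f fo; move: (eout _ fo); rewrite !inE => ->.
    by move: fo; rewrite inE => /andP[].
  by move: mM; rewrite -CeM inE (negPf mp).
have [x [q [perm pq Px nPy yx]]] := cycle_switch cp hP hnP.
have uq : uniq (x :: q) by rewrite (perm_uniq perm).
have memq e : (e \in x :: q) = (e \in C) by rewrite (perm_mem perm) inE.
(* Off the cycle greedy colouring works, as this set misses [z]. *)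
have [c0 pc0] : exists c, proper_coloring E Z0 k.+1 c.
  apply: degenerate_coloring => S SZ S0.
  have [/fintype.existsP[f /andP[fS lt]]|] :=
    boolP [exists f in S, #|outs E S f| < k.+1]; first by exists f.
  rewrite negb_exists => /fintype.forallP all.
  have SM : S = M.
    apply: (connected_outdegree cE rE fM) => //.
      exact: subset_trans SZ (subsetDl _ _).
    by move=> f fS; have := all f; rewrite fS /= -leqNgt.
  by have := subsetP SZ z; rewrite SM (pM z zp) !inE zp => /(_ isT).
set y := last x q in nPy yx.
have [u uo uC] := subsetPn nPy.
move: (uo); rewrite inE => /andP[uM yu].
have uZ : u \in Z0 by rewrite inE uC.
case: q => [|w q] in pq perm uq memq y nPy yx u uo uC uM yu uZ *.
  by case/negP: nPy.
have xC : x \in C by rewrite -memq mem_head.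
(* No out-neighbour of [x] is coloured yet, so that [x] may take any colour. *)
have pc1 : proper_coloring E (x |: Z0) k.+1
    (fun e => if e == x then c0 u else c0 e).
  apply: proper_coloring_extend => //.
  - by rewrite inE xC.
  - exact: pc0.1.
  - move=> f; rewrite !inE => /andP[/andP[fC fM'] xf].
    case/negP: fC; have := subsetP Px f; rewrite !inE fM' xf.
    exact.
have wqM : {subset w :: q <= M}.
  by move=> e eq; apply: (subsetP CM); rewrite -memq inE eq orbT.
have pwq : path (arc E) w q by case/andP: pq.
have /andP[xwq uwq] : (x \notin w :: q) && uniq (w :: q) by [].
have wqZ : {in w :: q, forall e, e \notin x |: Z0}.
  move=> e eq; rewrite in_setU1 in_setD -memq inE eq orbT /= orbF.
  by apply: contraNneq xwq => <-.
have [|e eM|c1 pc1' eq1] := path_coloring pc1 _ _ pwq uwq wqM wqZ.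
- by rewrite subUset sub1set (subsetP CM) // subsetDl.
- by rewrite oM.
set Z1 := _ :|: _ in pc1'.
have yE : y = last w q by [].
have yZ : y \notin Z1.
  rewrite in_setU negb_or wqZ ?yE ?mem_last //= inE.
  by move: uwq; rewrite lastI rcons_uniq => /andP[].
have Z1M : y |: Z1 = M.
  have wqE e : (e \in w :: q) = (e == y) || (e \in belast w q).
    by rewrite lastI mem_rcons in_cons -yE.
  apply/setP => e; rewrite in_setU1 !in_setU in_set1 in_setD -memq in_set.
  rewrite in_cons wqE.
  case: (eqVneq e y) => [->|ey] /=.
    by rewrite wqM // yE mem_last.
  case: (eqVneq e x) => [->|ex] /=; first by rewrite (subsetP CM).
  case: (boolP (e \in belast w q)) => [eb|] /=; last by rewrite orbF.
  by rewrite wqM // wqE eb orbT.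
have xZ1 : x \in x |: Z0 by rewrite !inE eqxx.
have uZ1 : u \in x |: Z0 by rewrite inE uZ orbT.
have ux : u != x by apply: contraNneq uC => ->.
have cxu : c1 x = c1 u by rewrite !eq1 // eqxx (negPf ux).
have [||i ik iP] := @free_color _ _ (outs E Z1 y) c1 k.
(* Dropping [x] from the out-neighbours of [y] loses no colour. *)
- have -> : [set (inord (c1 f) : 'I_k.+1) | f in outs E Z1 y] =
      [set (inord (c1 f) : 'I_k.+1) | f in outs E Z1 y :\ x].
    apply/eqP; rewrite eqEsubset andbC imsetS ?subsetDl //=.
    apply/subsetP => j /imsetP[f fo ->]; apply/imsetP.
    have [->|fx] := eqVneq f x; last by exists f; rewrite // in_setD1 fx.
    by exists u; rewrite ?cxu // in_setD1 ux in_set yu in_setU uZ1.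
  rewrite (leq_ltn_trans (leq_imset_card _ _)) // -(oM y).
    apply: proper_card; apply/properP; split.
      apply/subsetP => f /setD1P[_ /setIdP[fZ yf]].
      by apply/setIdP; rewrite -Z1M in_setU1 fZ orbT.
    by exists x; rewrite !inE ?eqxx // yx andbT (subsetP CM).
  by apply: (subsetP CM); rewrite -memq yE inE mem_last orbT.
- by move=> f; rewrite inE => /andP[/pc1'.1].
exists (fun e => if e == y then i else c1 e).
by rewrite -Z1M; exact: proper_coloring_extend.
Qed.

(** The second matching [N] joins the [A]-end of each edge of [M] to the [B]-end
of the next one, so that [M :|: N] is a Hamiltonian cycle of [E].  Without the
edge [e0] it has no [2]-regular component: such a component would be saturated
in the cycle, hence contain [e0]. *)
Lemma decomposable_hamiltonian (A B : finType) (k : nat)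
    (E M : {set A * B}) p :
  biregular k.+2 E -> factor 1 E M -> uniq p -> p =i M -> p != [::] ->
  cycle (arc E) p -> decomposable ('C(k.+2, 2) + 2) E.
Proof.
case: p => // e0 s rE fM; set p := e0 :: s => up pM _ cp.
have mM := factor1_matching fM; have [ME cM] := fM.
have nM e : e \in M -> next p e \in M by rewrite -!pM mem_next.
have nE e : e \in M -> arc E e (next p e) by rewrite -pM; exact: next_cycle.
pose N := [set (e.1, (next p e).2) | e in M].
have NE : N \subset E.
  by apply/subsetP => _ /imsetP[e /nE/andP[_ eE] ->].
have fN : factor 1 E N.
  split=> // e eE; have [/eqP/cards1P[b rb] /eqP/cards1P[a ca]] := cM e eE.
  have ebM : (e.1, b) \in M by move/setP/(_ b): rb; rewrite !inE eqxx.
  have eaM : (a, e.2) \in M by move/setP/(_ a): ca; rewrite !inE eqxx.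
  split; apply/eqP/cards1P.
    exists (next p (e.1, b)).2; apply/setP => x; rewrite !inE.
    apply/imsetP/eqP => [[f fM' [e1f ->]]|->]; last by exists (e.1, b).
    by rewrite (mM f (e.1, b)) //; left.
  exists (prev p (a, e.2)).1; apply/setP => x; rewrite !inE.
  have pvM : prev p (a, e.2) \in M by rewrite -pM mem_prev pM.
  apply/imsetP/eqP => [[f fM' [-> e2f]]|->]; last first.
    by exists (prev p (a, e.2)); rewrite // next_prev.
  by rewrite -(mM (next p f) (a, e.2)) ?prev_next ?nM //; right.
have dMN : [disjoint M & N].
  rewrite disjoint_sym disjoint_subset; apply/subsetP => _ /imsetP[e eM ->].
  rewrite inE; apply/negP => enM; have /andP[/negP nx _] := nE e eM; apply: nx.
  have e1 : (e.1, (next p e).2) = e by apply: mM => //; left.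
  have e2 : (e.1, (next p e).2) = next p e by apply: mM => //; [exact: nM | right].
  by rewrite -[X in X == _]e2 e1.
have fC := factorU dMN fM fN; have [CE cC] := fC.
have e0M : e0 \in M by rewrite -pM mem_head.
have e0N : e0 \notin N by rewrite (disjointFr dMN).
pose Q := E :\: (M :|: N).
have rQ : biregular k Q by have := factorD rE fC; rewrite !subSS subn0.
(* Following [N] and then [M] leads from an edge of [M] to the next one, and
   thus all the way round the cycle. *)
have connC F : saturated (M :|: N) F -> F != set0 -> e0 \in F.
  move=> [FC sF] /set0Pn[f fF].
  have nF e : e \in M -> e \in F -> next p e \in F.
    move=> eM eF; apply: (sF (e.1, (next p e).2)); last by right.
      apply: (sF e) => //; last by left.
      by rewrite inE [X in _ || X]imset_f // orbT.
    by rewrite inE nM.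
  have [e eM eF] : exists2 e, e \in M & e \in F.
    have := subsetP FC f fF; rewrite inE => /orP[fM'|/imsetP[e eM fe]].
      by exists f.
    exists e => //; apply: (sF f) => //; first by rewrite inE eM.
    by left; rewrite fe.
  apply/negPn/negP => e0F.
  have cnp := cycle_next up.
  have [||x [q [perm pq xF lF /eqP lx]]] := cycle_switch (P := fun e => e \notin F) cnp.
  - by apply/hasP; exists e0; rewrite ?mem_head.
  - by apply/hasP; exists e; rewrite ?pM //= negbK.
  move: lF; rewrite negbK => lF; case/negP: xF; rewrite -lx; apply: nF => //.
  by rewrite -pM -(perm_mem perm) mem_last.
have free : regular_component_free 2 ((M :\ e0) :|: N).
  move=> F sF rF; apply/eqP/negPn/negP => F0.
  have FC : F \subset M :|: N.
    by apply: subset_trans sF.1 _; apply/setSU/subsetDl.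
  suff satF : saturated (M :|: N) F.
    have := subsetP sF.1 e0 (connC F satF F0).
    by rewrite !inE eqxx (negPf e0N).
  split=> // e f eF fC' ef; have [fe0|fe0] := eqVneq f e0; last first.
    apply: (sF.2 e) => //; move: fC'; rewrite !in_setU in_setD1 fe0 /= => ->//.
  have eE := subsetP CE _ (subsetP FC _ eF).
  have [r2 c2] := rF.2 e eF; have [r2' c2'] := cC e eE.
  case: ef => ef.
    have eqr : row_of F e.1 = row_of (M :|: N) e.1.
      apply/eqP; rewrite eqEcard r2 r2' leqnn andbT.
      by apply/subsetP => x; rewrite !inE => /(subsetP FC); rewrite inE.
    have : f.2 \in row_of F e.1 by rewrite eqr in_set ef -surjective_pairing.
    by rewrite in_set ef -surjective_pairing.
  have eqc : col_of F e.2 = col_of (M :|: N) e.2.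
    apply/eqP; rewrite eqEcard c2 c2' leqnn andbT.
    by apply/subsetP => x; rewrite !inE => /(subsetP FC); rewrite inE.
  have : f.1 \in col_of F e.2 by rewrite eqc in_set ef -surjective_pairing.
  by rewrite in_set ef -surjective_pairing.
rewrite addnS -add1n.
apply: (@decomposable_colored _ _ _ _ _ [set e0] (fun=> 0)).
- by rewrite sub1set (subsetP ME).
- by move=> e f /set1P-> /set1P->.
- split=> // i S SM /set0Pn[e eS]; exists e; split=> // f fS.
  have := subsetP SM f fS; have := subsetP SM e eS.
  by rewrite !inE => /andP[/eqP-> _] /andP[/eqP-> _]; rewrite /arc /= eqxx.
have -> : E :\ e0 = (M :\ e0) :|: N :|: Q.
  apply/setP => e; rewrite !in_setU !in_setD in_setU in_set1.
  have [->|ee0] /= := eqVneq e e0; first by rewrite (negPf e0N) e0M.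
  case: (boolP (e \in M)) => [/(subsetP ME)->//|_] /=.
  by case: (boolP (e \in N)) => [/(subsetP NE)->//|_].
apply: decomposable_path => //.
- by apply: matchingS mM; apply: subsetDl.
- exact: factor1_matching fN.
- rewrite disjoint_sym disjoints_subset; apply/subsetP => e; rewrite in_setD => /andP[+ _].
  rewrite in_setC; apply: contra; rewrite !in_setU in_setD1.
  by case/orP => [/andP[_ ->]|->]; rewrite ?orbT.
Qed.

(** * The bound for regular bipartite graphs *)

(** Disconnected graphs have to be included, as removing a perfect matching may
disconnect a graph; they are handled by an inner induction on the number of
edges. *)
Lemma biregular_decomposable (A B : finType) (d : nat) (E : {set A * B}) :
  biregular d E -> decomposable ('C(d, 2) + 2) E.
Proof.
elim: d E => [|d IHd] E rE.
  have -> : E = set0.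
    apply/eqP/negPn/negP => /set0Pn[[a b] abE].
    have [/eqP] := rE.2 _ abE; rewrite cards_eq0 => /eqP/setP/(_ b).
    by rewrite !inE abE.
  exact: decomposable_leq (decomposable0 A B).
case: d IHd rE => [_ rE|k IHd rE].
  by apply: decomposable_leq (decomposable_matching (factor1_matching rE)).
elim: {E}_.+1 {-2}E (ltnSn #|E|) rE => // n IH E leE rE.
have [cE|] := pselect (connected_edges E); last first.
  move=> /existsNP[F /not_implyP[sF /not_implyP[F0 /eqP FE]]].
  have <- : F :|: (E :\: F) = E by rewrite -{1}(setIidPr sF.1) setID.
  have FpE : F \proper E by rewrite properEneq FE sF.1.
  apply: decomposableU.
  - move=> e f eF; rewrite inE => /andP[fF fE].
    by split; apply: contra fF => /eqP ef; apply: (sF.2 e); auto.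
  - apply: IH; last exact: saturated_biregular rE.
    by apply: leq_trans (proper_card FpE) _; rewrite -ltnS.
  - apply: IH; last exact: saturated_biregular (saturatedD sF) rE.
    rewrite -ltnS; apply: leq_trans leE; rewrite ltnS.
    by rewrite cardsDS ?sF.1 // ltn_subrL !card_gt0 F0 (subset_neq0 sF.1).
have [->|E0] := eqVneq E set0.
  exact: decomposable_leq (decomposable0 A B).
have [M fM] := biregular_perfect_matching rE; have [ME _] := fM.
have M0 : M != set0.
  have [e eE] := set0Pn _ E0; have [/eqP/cards1P[b rb] _] := fM.2 e eE.
  by move/setP/(_ b): rb; rewrite !inE eqxx => ebM; apply/set0Pn; exists (e.1, b).
have [|p [up pM cp [z zp zo]]] := exists_dicycle (E := E) M0.
  by move=> e /(card_outs rE fM)[oe]; rewrite -card_gt0 oe.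
have [/subsetP Mp|/subsetPn[m mM mp]] := boolP (M \subset p).
  apply: (decomposable_hamiltonian rE fM up) => //.
    by move=> e; apply/idP/idP => [/pM|/Mp].
  by case: (p) zp.
have [c pc] := brooks_coloring cE rE fM pM up cp zp zo mM mp.
rewrite binS bin1 [('C(_, _) + _)%N]addnC -addnA.
apply: decomposable_colored pc _ => //; first exact: factor1_matching fM.
by apply: IHd; have := factorD rE fM; rewrite subn1.
Qed.

(** * From simple graphs to sets of pairs *)

(** The edges oriented from [A] to its complement, which makes a pair out of
each two-element set. *)
Definition crossing (G : sgraph) (A : {set G}) : {set G * G} :=
  [set e | (e.1 \in A) && adj e.1 e.2].

Definition unordered (G : sgraph) (F : {set G * G}) : {set {set G}} :=
  [set [set e.1; e.2] | e in F].

Lemma crossing_notin (G : sgraph) (A : {set G}) (e : G * G) :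
  (forall x y : G, adj x y -> (x \in A) != (y \in A)) ->
  e \in crossing A -> e.1 \in A /\ e.2 \notin A.
Proof.
by move=> bip; rewrite inE => /andP[eA /bip]; rewrite eA; case: (e.2 \in A).
Qed.

Lemma crossing_set2 (G : sgraph) (A : {set G}) (e : G * G) (u v : G) :
  (forall x y : G, adj x y -> (x \in A) != (y \in A)) ->
  e \in crossing A -> [set u; v] = [set e.1; e.2] -> e = (u, v) \/ e = (v, u).
Proof.
move=> bip /(crossing_notin bip)[e1 e2] uv.
have : e.1 \in [set u; v] by rewrite uv !inE eqxx.
have : e.2 \in [set u; v] by rewrite uv !inE eqxx orbT.
rewrite !inE [e]surjective_pairing /=.
case/orP=> /eqP e2E /orP[]/eqP e1E; rewrite e1E e2E; auto;
  by move: e1 e2; rewrite e1E e2E => ->.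
Qed.

Lemma unordered_inj (G : sgraph) (A : {set G}) :
  (forall x y : G, adj x y -> (x \in A) != (y \in A)) ->
  {in crossing A &, injective (fun e : G * G => [set e.1; e.2])}.
Proof.
move=> bip e f eE fE /esym/(crossing_set2 bip eE)[->|ef].
  by rewrite -surjective_pairing.
have [+ _] := crossing_notin bip eE; have [_] := crossing_notin bip fE.
by rewrite ef /= => /negPf->.
Qed.

Lemma positive_matching_unordered (R : realType) (G : sgraph) (A : {set G})
    (F M : {set G * G}) :
  (forall x y : G, adj x y -> (x \in A) != (y \in A)) ->
  F \subset crossing A -> positive F M ->
  positive_matching R (unordered F) (unordered M).
Proof.
move=> bip /subsetP FE [/subsetP MF mM [wa [wb wP]]].
have ext e (eF : e \in F) := crossing_notin bip (FE e eF).
split.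
- by apply/imsetS/subsetP.
- apply/trivIsetP => _ _ /imsetP[e eM ->] /imsetP[f fM ->] ef.
  rewrite -setI_eq0; apply/eqP/setP => x; rewrite !inE; apply/negP => /andP[xe xf].
  have [e1 e2] := ext e (MF e eM); have [f1 f2] := ext f (MF f fM).
  case/negP: ef; apply/eqP; suff -> : e = f by [].
  apply: mM => //; have [xA|xA] := boolP (x \in A).
    left; case/orP: xe => /eqP xe; last by rewrite -xe xA in e2.
    by case/orP: xf => /eqP xf; [rewrite -xe | rewrite -xf xA in f2].
  right; case/orP: xe => /eqP xe; first by rewrite xe e1 in xA.
  by case/orP: xf => /eqP xf; [rewrite xf f1 in xA | rewrite -xe].
pose w x : R := if x \in A then (wa x)%:~R%R else (wb x)%:~R%R.
have wE e : e \in F -> (w e.1 + w e.2 = (wa e.1 + wb e.2)%:~R)%R.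
  by move=> /ext[e1 e2]; rewrite /w e1 (negPf e2) intrD.
have wS u v e : e \in F -> [set u; v] = [set e.1; e.2] ->
    (w u + w v = (wa e.1 + wb e.2)%:~R)%R.
  move=> eF /(crossing_set2 bip (FE e eF)) uv; rewrite -wE //.
  by case: uv => ->; rewrite //= addrC.
exists w; split=> u v.
  move=> /imsetP[e eM uv]; rewrite (wS _ _ e) ?MF // ltr0z.
  by have := wP e (MF e eM); rewrite eM.
rewrite inE => /andP[uvM /imsetP[e eF uv]]; rewrite (wS _ _ e) // ltrz0.
have := wP e eF; case: ifP => // eM _; case/negP: uvM.
by rewrite uv; apply/imsetP; exists e.
Qed.

Lemma has_pmd_decomposable (R : realType) (G : sgraph) (A : {set G}) (p : nat) :
  (forall x y : G, adj x y -> (x \in A) != (y \in A)) ->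
  decomposable p (crossing A) -> has_pmd R G p.
Proof.
move=> bip [c [cp cP]]; set E := crossing A in cp cP.
have edgesE : edges G = unordered E.
  apply/setP => s; apply/imsetP/imsetP => -[[x y] /=]; rewrite inE /= => xy ->.
    have := bip x y xy; case: (boolP (x \in A)) => xA /=.
      by exists (x, y); rewrite // inE /= xA.
    move=> /negPn yA.
    by exists (y, x); [rewrite inE /= yA adj_sym | rewrite setUC].
  by case/andP: xy => _ xy; exists (x, y); rewrite ?inE.
have uinj := unordered_inj bip.
pose part (i : 'I_p) := unordered [set e in E | c e == i].
exists part; split.
- rewrite edgesE; apply/setP => s; apply/bigcupP/imsetP.
    move=> [i _ /imsetP[e]]; rewrite inE => /andP[eE _] ->.
    by exists e.
  move=> [e eE ->]; exists (Ordinal (cp e eE)) => //.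
  by apply/imsetP; exists e; rewrite // inE eE /=.
- move=> i j ij; rewrite -setI_eq0; apply/eqP/setP => s; rewrite !inE.
  apply/negP => /andP[/imsetP[e + ->] /imsetP[f + ef]].
  move=> /setIdP[eE /eqP ci] /setIdP[fE /eqP cj].
  by case/negP: ij; apply/eqP/val_inj; rewrite /= -ci -cj (uinj _ _ eE fE ef).
move=> i; have -> : edges G :\: \bigcup_(j < p | (j < i)%N) part j =
    unordered [set e in E | i <= c e].
  rewrite edgesE; apply/setP => s; rewrite inE; apply/andP/imsetP.
    move=> [np /imsetP[e eE se]]; exists e; rewrite // inE eE leqNgt.
    apply: contra np => ci; apply/bigcupP; exists (Ordinal (cp e eE)) => //.
    by apply/imsetP; exists e; rewrite // inE eE /=.
  move=> [e /setIdP[eE ic] ->]; split; last first.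
    by apply/imsetP; exists e.
  apply/bigcupP => -[j ji /imsetP[f /setIdP[fE /eqP cf] ef]].
  by move: ji; rewrite -cf -(uinj _ _ eE fE ef) ltnNge ic.
apply: (@positive_matching_unordered _ _ A _ _ bip _ (cP i)).
by apply/subsetP => e; rewrite !inE => /andP[].
Qed.

Lemma crossing_biregular (G : sgraph) (A : {set G}) (r : nat) :
  (forall x y : G, adj x y -> (x \in A) != (y \in A)) -> regular r G ->
  biregular r (crossing A).
Proof.
move=> bip reg; split=> // -[a b] abE; have [/= aA bA] := crossing_notin bip abE.
split.
  by rewrite -(reg a); apply: eq_card => y; rewrite !inE /= aA.
rewrite -(reg b); apply: eq_card => x; rewrite !inE /= adj_sym.
by case: (boolP (adj b x)) => [/bip|_]; rewrite ?andbF // (negPf bA); case: (x \in A).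
Qed.

Theorem theorem3p10 (R : realType) (r : nat) (G : sgraph) :
  connected G -> regular r G -> bipartite G -> (pmd R G <= 'C(r, 2) + 2)%N.
Proof.
move=> _ reg [A bip]; rewrite /pmd; case: ex_minnP => p _; apply; apply/asboolP.
exact: has_pmd_decomposable bip (biregular_decomposable (crossing_biregular bip reg)).
Qed.
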